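(* The endograph metric $D_E$ on $\mathbb{E}^1$ has the following properties. (i) For all $u\in\mathbb{E}^1$ and $\alpha,\beta\in\mathbb{R}$, $$D_E(\alpha u,\beta u)\leq |\alpha-\beta|\max\{|z| : z\in[u]^{0}\}.$$ (ii) For all $n\ge1$ and $u_j,v_j\in\mathbb{E}^1$, $j=1,\dots,n$, setting $u=\sum_{j=1}^{n}u_j$ and $v=\sum_{j=1}^{n}v_j$, $$D_E(u,v)\leq \sum_{j=1}^{n} D_E(u_j,v_j).$$ (iii) For all $u,v,w\in\mathbb{E}^1$ and $\alpha\in[0,1]$, $$D_E(\alpha u+(1-\alpha) v,w)\leq\sqrt{D_E(u,w)^2+D_E(v,w)^2}.$$ (iv) For all $u,v,w\in\mathbb{E}^1$ and $\alpha\in[0,1]$, $$D_E(\alpha u+(1-\alpha) v,w)\leq\sqrt{2}\,\max\{D_E(u,w),D_E(v,w)\}.$$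
   Context: Fuzzy numbers: for $u:\mathbb{R}\to[0,1]$ put $[u]^{\lambda}=\{x\in\mathbb{R}: u(x)\ge\lambda\}$ for $\lambda\in(0,1]$ and $[u]^0=\overline{\{x\in\mathbb{R}: u(x)>0\}}$. A fuzzy number is a function $u:\mathbb{R}\to[0,1]$ such that: there is $x$ with $u(x)=1$; $u$ is upper semicontinuous; $u(\alpha x+(1-\alpha)y)\ge\min\{u(x),u(y)\}$ for all $x,y\in\mathbb{R}$, $\alpha\in[0,1]$; and $[u]^0$ is compact. $\mathbb{E}^1$ is the set of fuzzy numbers. Arithmetic: for $u,v\in\mathbb{E}^1$ and $c\in\mathbb{R}$, $u+v$ and $cu$ are the fuzzy numbers determined levelwise by $[u+v]^\lambda=[u]^\lambda+[v]^\lambda$ (Minkowski sum) and $[cu]^\lambda=c[u]^\lambda$, $\lambda\in[0,1]$. Endograph metric: $\mathrm{end}(u)=\{(x,\beta)\in\mathbb{R}\times[0,1]: u(x)\ge\beta\}$, a closed set, and $D_E(u,v)=d_H(\mathrm{end}(u),\mathrm{end}(v))$, where $d_H(A,B)=\max\{\sup_{p\in A}\inf_{q\in B}d(p,q),\ \sup_{q\in B}\inf_{p\in A}d(p,q)\}$ is the Hausdorff distance in $\mathbb{R}\times[0,1]$ with the Euclidean metric $d$. *)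

(* Defs.v *)
From HB Require Import structures.
From mathcomp Require Import all_boot all_order all_algebra.
From mathcomp Require Import all_classical all_reals all_analysis.
From mathcomp Require Import lra.

Set Implicit Arguments.
Unset Strict Implicit.
Unset Printing Implicit Defensive.

Import Order.TTheory GRing.Theory Num.Theory.
Import numFieldNormedType.Exports.

Local Open Scope classical_set_scope.
Local Open Scope ring_scope.

Section FuzzyNumbers.
Variable R : realType.
Implicit Types (u v w : R -> R) (l m x y : R).

(* The [l]-level set of [u], meant for [0 <= l <= 1]. *)
Definition level u l : set R :=
  if l == 0 then closure [set x | 0 < u x] else [set x | l <= u x].

Definition upper_semicontinuous u :=
  forall x l, u x < l -> \forall y \near x, u y < l.

Record is_fuzzy_number u : Prop := IsFuzzyNumber {
  fuzzy_itv : forall x, 0 <= u x <= 1;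
  fuzzy_normal : exists x, u x = 1;
  fuzzy_usc : upper_semicontinuous u;
  fuzzy_quasiconcave : forall x y l, 0 <= l <= 1 ->
    Num.min (u x) (u y) <= u (l * x + (1 - l) * y);
  fuzzy_compact : compact (level u 0) }.

(* The function whose [l]-levels are [L l] for [0 <= l <= 1], when there is one
   ([sup set0 = 0] takes care of the points lying in no [L l]). *)
Definition of_levels (L : R -> set R) (x : R) : R :=
  sup [set l | 0 <= l <= 1 /\ L l x].

(* Conditions under which a family of compact convex sets is the family of
   levels of a fuzzy number; see [level_of_levels] and [of_levels_fuzzy]. *)
Record is_level_family (T : topologicalType) (L : R -> set T) : Prop :=
  IsLevelFamily {
  lf_homo : forall l m, 0 <= l -> l <= m -> m <= 1 -> L m `<=` L l;
  lf_nonempty : L 1 !=set0;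
  lf_compact : forall l, 0 <= l <= 1 -> compact (L l);
  lf_left : forall l, 0 < l <= 1 ->
    forall t, (forall m, 0 < m -> m < l -> L m t) -> L l t;
  lf_closure : L 0 = closure [set t | exists2 m, 0 < m <= 1 & L m t] }.

Definition is_convex_set (A : set R) := forall x y l, A x -> A y ->
  0 <= l <= 1 -> A (l * x + (1 - l) * y).

Lemma Rhausdorff : hausdorff_space R. Proof. exact: norm_hausdorff. Qed.

Section of_levels.
Variable L : R -> set R.
Hypothesis LF : is_level_family L.

Let S x := [set l | 0 <= l <= 1 /\ L l x].

Let S_ub x : ubound (S x) 1.
Proof. by move=> l [/andP[]]. Qed.

Let of_levels_itv x : 0 <= of_levels L x <= 1.
Proof.
rewrite /of_levels; have [S0|/nonemptyPn S0] := pselect (S x !=set0); last first.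
  by rewrite -/(S x) S0 sup0 lexx ler01.
apply/andP; split; last by apply: ge_sup => //; exact: S_ub.
have [l [l01 Ll]] := S0; have [l0 _] := andP l01.
by apply: (le_trans l0); apply: ub_le_sup; [exists 1; exact: S_ub|].
Qed.

Let le_of_levels x l : 0 < l <= 1 -> (l <= of_levels L x) <-> L l x.
Proof.
move=> /andP[l0 l1]; split; last first.
  move=> Ll; apply: ub_le_sup; first by exists 1; exact: S_ub.
  by split => //; rewrite ltW.
move=> lS; apply: (lf_left LF); first by rewrite l0.
move=> m m0 ml.
have S0 : S x !=set0.
  apply: contrapT => /nonemptyPn S0; move: lS.
  by rewrite /of_levels -/(S x) S0 sup0 leNgt l0.
have [k [/andP[k0 k1] Lk] mk] : exists2 k, S x k & m < k.
  by apply: sup_gt => //; exact: lt_le_trans lS.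
by apply: (lf_homo LF) Lk => //; exact: ltW.
Qed.

Lemma level_of_levels l : 0 <= l <= 1 -> level (of_levels L) l = L l.
Proof.
move=> /andP[l0 l1]; rewrite /level; case: eqP => [->|/eqP ln0]; last first.
  by apply/seteqP; split => x /le_of_levels; apply; rewrite lt_neqAle eq_sym ln0 l0.
rewrite (lf_closure LF); congr closure; apply/seteqP; split => x /=.
  move=> x0; exists (of_levels L x); first by rewrite x0; case/andP: (of_levels_itv x).
  by apply/le_of_levels => //; rewrite x0; case/andP: (of_levels_itv x).
move=> [m m01 /(le_of_levels x m01)]; apply: lt_le_trans.
by case/andP: m01.
Qed.

Hypothesis LC : forall l, 0 <= l <= 1 -> is_convex_set (L l).

Lemma of_levels_fuzzy : is_fuzzy_number (of_levels L).
Proof.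
have r01 : 0 <= (1 : R) <= 1 by rewrite ler01 lexx.
have r01' : 0 < (1 : R) <= 1 by rewrite ltr01 lexx.
split.
- exact: of_levels_itv.
- have [x Lx] := lf_nonempty LF; exists x; apply/eqP; rewrite eq_le.
  by have /andP[_ ->] := of_levels_itv x; apply/le_of_levels.
- move=> x l xl; have [l1|l1] := leP l 1; last first.
    near=> y; apply: le_lt_trans l1.
    by case/andP: (of_levels_itv y).
  have l0 : 0 < l by apply: le_lt_trans xl; case/andP: (of_levels_itv x).
  have l01 : 0 < l <= 1 by rewrite l0.
  have : nbhs x (~` L l).
    apply: open_nbhs_nbhs; split.
      apply: closed_openC; apply: (compact_closed Rhausdorff).
      by apply: (lf_compact LF); rewrite l1 ltW.
    by move=> /(le_of_levels x l01); rewrite leNgt xl.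
  apply: filterS => y Ly; rewrite ltNge; apply/negP => /(le_of_levels y l01).
  exact: Ly.
- move=> x y a a01; set m := Num.min _ _.
  have m1 : m <= 1 by rewrite ge_min; case/andP: (of_levels_itv x) => _ ->.
  have [m0|m0] := leP m 0.
    by apply: le_trans m0 _; case/andP: (of_levels_itv (a * x + (1 - a) * y)).
  have m01 : 0 < m <= 1 by rewrite m0.
  apply/le_of_levels => //; apply: LC => //; first by rewrite ltW.
    by apply/le_of_levels => //; rewrite ge_min lexx.
  by apply/le_of_levels => //; rewrite ge_min lexx orbT.
- rewrite level_of_levels ?lexx ?ler01//; apply: (lf_compact LF).
  by rewrite lexx ler01.
Unshelve. all: by end_near. Qed.

End of_levels.

Section image.
Variables (T : topologicalType) (K : R -> set T) (f : T -> R).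
Hypotheses (hT : hausdorff_space T) (KF : is_level_family K).
Hypothesis cf : continuous f.

Lemma image_level_family : is_level_family (fun l => f @` K l).
Proof.
have cpt l : 0 <= l <= 1 -> compact (f @` K l).
  move=> l01; apply: continuous_compact; last exact: (lf_compact KF).
  exact: continuous_subspaceT.
split => //.
- by move=> l m l0 lm m1; apply: image_subset; exact: (lf_homo KF).
- by have [t Kt] := lf_nonempty KF; exists (f t), t.
- move=> l /andP[l0 l1] x Kx.
  pose D := [set m : R | 0 < m /\ m < l].
  pose B m := K m `&` f @^-1` [set x].
  pose F := filter_from D B.
  have hl : D (l / 2) by rewrite /D/=; split; lra.
  have FF : Filter F.
    apply: filter_from_filter; first by exists (l / 2).
    move=> i j [i0 il] [j0 jl]; exists (Num.max i j).
      by split; rewrite ?lt_max ?i0// gt_max il jl.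
    have m1 : Num.max i j <= 1 by rewrite ge_max; apply/andP; split; lra.
    move=> t [Kt ft]; split; split => //; apply: (lf_homo KF) Kt => //;
      by [exact: ltW | rewrite le_max lexx ?orbT].
  have PF : ProperFilter F.
    apply: filter_from_proper => i [i0 il].
    by have [t Kt ft] := Kx _ i0 il; exists t; split.
  have Fh : F (K (l / 2)) by exists (l / 2) => // t [].
  have h01 : 0 <= l / 2 <= 1 by apply/andP; split; lra.
  have [p [Kp clp]] := lf_compact KF h01 PF Fh.
  have Bp m : D m -> B m p.
    move=> Dm.
    have cB : closed (B m).
      apply: closedI.
        apply: (compact_closed hT); apply: (lf_compact KF).
        by case: Dm => m0 ml; apply/andP; split; lra.
      apply: closed_comp => //; apply: closed_eq.
    move: clp; rewrite clusterE => /(_ (B m)).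
    by rewrite -(closure_id _).1//; apply; exists m.
  exists p; last by have [] := Bp _ hl.
  apply: (lf_left KF); first by rewrite l0.
  by move=> m m0 ml; have [] := Bp m (conj m0 ml).
- apply/seteqP; split => [_ [t + <-]|].
    rewrite (lf_closure KF) => clt B fB.
    have [s [[m m01 Ks] Bs]] := clt _ (cf fB).
    by exists (f s); split => //; exists m => //; exists s.
  have cK0 : closed (f @` K 0).
    by apply: (compact_closed Rhausdorff); apply: cpt; rewrite lexx ler01.
  rewrite [X in _ `<=` X](closure_id _).1//.
  apply: closure_subset => _ [m /andP[m0 m1]] [t Kt <-]; exists t => //.
  by apply: (lf_homo KF) Kt => //; exact: ltW.
Qed.

End image.


Section levels.
Variable u : R -> R.
Hypothesis fu : is_fuzzy_number u.

Lemma level_family : is_level_family (level u).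
Proof.
have u01 := fuzzy_itv fu.
have homo l m : 0 <= l -> l <= m -> m <= 1 -> level u m `<=` level u l.
  rewrite le_eqVlt => /predU1P[<-|l0 lm m1].
    rewrite {2}/level eqxx /level; case: eqP => [_ _ _ x//|/eqP mn0 m0 _ x /= mx].
    by apply: subset_closure => /=; apply: (lt_le_trans _ mx); rewrite lt_neqAle eq_sym mn0.
  rewrite /level !gt_eqF//; last exact: (lt_le_trans l0 lm).
  by move=> x /=; exact: le_trans.
split => //.
- have [x ux] := fuzzy_normal fu; exists x.
  by rewrite /level oner_eq0/= ux.
- move=> l /andP[]; rewrite le_eqVlt => /predU1P[<- _|l0 l1].
    exact: fuzzy_compact fu.
  apply: (subclosed_compact _ (fuzzy_compact fu)); last exact: homo (ltW l0) _.
  rewrite /level gt_eqF//.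
  have -> : [set x | l <= u x] = ~` [set x | u x < l].
    by apply/seteqP; split => x /=; rewrite leNgt => /negP.
  apply: open_closedC; rewrite openE => x /= xl.
  exact: (fuzzy_usc fu).
- move=> l /andP[l0 l1] t lt; rewrite /level gt_eqF//= leNgt; apply/negP => utl.
  have [ut0 _] := andP (u01 t).
  have m0 : 0 < (u t + l) / 2 by lra.
  have ml : (u t + l) / 2 < l by lra.
  by move: (lt _ m0 ml); rewrite /level gt_eqF//=; lra.
- rewrite {1}/level eqxx; congr closure; apply/seteqP; split => x /=.
    move=> x0; exists (u x); first by rewrite x0; case/andP: (u01 x).
    by rewrite /level gt_eqF/=.
  move=> [m /andP[m0 _]]; rewrite /level gt_eqF//=; exact: lt_le_trans.
Qed.

Lemma level_convex l : 0 <= l <= 1 -> is_convex_set (level u l).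
Proof.
have conv1 m : 0 < m -> is_convex_set (level u m).
  move=> m0 x y a; rewrite /level gt_eqF//= => mx my a01.
  by apply: le_trans (fuzzy_quasiconcave fu _ _ a01); rewrite le_min mx.
move=> /andP[]; rewrite le_eqVlt => /predU1P[<- _|l0 _]; last exact: conv1.
move=> x y a; rewrite /level eqxx => clx cly a01.
have cf : continuous (fun p : R * R => a * p.1 + (1 - a) * p.2).
  move=> p; apply: cvgD; apply: cvgMr => //; [exact: cvg_fst|exact: cvg_snd].
move=> B /(cf (x, y))[[/= B1 B2] [Bx By] BB].
have [x' [ux' Bx']] := clx _ Bx; have [y' [uy' By']] := cly _ By.
exists (a * x' + (1 - a) * y'); split; last exact: (BB (x', y')).
by apply: lt_le_trans (fuzzy_quasiconcave fu _ _ a01); rewrite lt_min ux'.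
Qed.

End levels.

Definition minkowski_sum (A B : set R) : set R := [set x + y | x in A & y in B].

Definition minkowski_scale (c : R) (A : set R) : set R := [set c * x | x in A].

Lemma minkowski_sum_family u v : is_fuzzy_number u -> is_fuzzy_number v ->
  is_level_family (fun l => minkowski_sum (level u l) (level v l)).
Proof.
move=> /level_family fu /level_family fv.
have -> : (fun l => minkowski_sum (level u l) (level v l)) =
    (fun l => (fun p : R * R => p.1 + p.2) @` (level u l `*` level v l)).
  apply/funext => l; apply/seteqP; split.
    by move=> _ [x ux [y vy <-]]; exists (x, y).
  by move=> _ [[x y] [ux vy] <-]; exists x => //; exists y.
apply: image_level_family; first exact: norm_hausdorff; last first.
  by move=> p; apply: cvgD; [exact: cvg_fst|exact: cvg_snd].
split.
- move=> l m l0 lm m1 [x y] [ux vy]; split; [exact: (lf_homo fu l0 lm m1)|exact: (lf_homo fv l0 lm m1)].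
- have [x ux] := lf_nonempty fu; have [y vy] := lf_nonempty fv.
  by exists (x, y).
- by move=> l l01; apply: compact_setX; [exact: (lf_compact fu)|exact: (lf_compact fv)].
- move=> l l01 [x y] h; split; [apply: (lf_left fu l01)|apply: (lf_left fv l01)];
    by move=> m m0 ml; have [] := h m m0 ml.
- apply/seteqP; split => [[x y] []|]; last first.
    have c0 : closed (level u 0 `*` level v 0).
      apply: compact_closed; first exact: norm_hausdorff.
      by apply: compact_setX; [apply: (lf_compact fu)|apply: (lf_compact fv)];
        rewrite lexx ler01.
    rewrite [X in _ `<=` X](closure_id _).1//; apply: closure_subset.
    move=> [x y] [m /andP[m0 m1] [ux vy]]; split.
      by apply: (lf_homo fu) ux => //; exact: ltW.
    by apply: (lf_homo fv) vy => //; exact: ltW.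
  rewrite /= (lf_closure fu) (lf_closure fv) => clx cly B [[B1 B2] [/= Bx By] BB].
  have [x' [[m /andP[m0 m1] ux'] Bx']] := clx _ Bx.
  have [y' [[k /andP[k0 k1] vy'] By']] := cly _ By.
  exists (x', y'); split; last exact: (BB (x', y')).
  have mk0 : 0 < Num.min m k by rewrite lt_min m0.
  exists (Num.min m k); first by rewrite mk0 ge_min m1.
  split; [apply: (lf_homo fu) ux'|apply: (lf_homo fv) vy'] => //;
    by [exact: ltW | rewrite ge_min lexx ?orbT].
Qed.

Lemma minkowski_sum_convex A B : is_convex_set A -> is_convex_set B ->
  is_convex_set (minkowski_sum A B).
Proof.
move=> cA cB _ _ a [x Ax [y By <-]] [x' Ax' [y' By' <-]] a01.
exists (a * x + (1 - a) * x'); first exact: cA.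
by exists (a * y + (1 - a) * y'); [exact: cB|lra].
Qed.

Lemma minkowski_scale_family c u : is_fuzzy_number u ->
  is_level_family (fun l => minkowski_scale c (level u l)).
Proof.
move=> /level_family fu; apply: (@image_level_family _ _ _ Rhausdorff fu).
exact: mulrl_continuous.
Qed.

Lemma minkowski_scale_convex c A : is_convex_set A ->
  is_convex_set (minkowski_scale c A).
Proof.
move=> cA _ _ a [x Ax <-] [y Ay <-] a01.
by exists (a * x + (1 - a) * y); [exact: cA|lra].
Qed.

Lemma set1_family : is_level_family (fun=> [set 0 : R]).
Proof.
split.
- by move=> l m _ _ _ x.
- by exists 0.
- by move=> *; exact: compact_set1.
- move=> l /andP[l0 _] t h; apply: (h (l / 2)); lra.
- have /closure_id E : closed [set 0 : R].
    by apply: compact_closed; [exact: Rhausdorff|exact: compact_set1].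
  rewrite [LHS]E; congr closure; apply/seteqP; split => [_ ->|x [m _]//].
  by exists 1; rewrite // ltr01 lexx.
Qed.

Lemma set1_convex : is_convex_set [set 0].
Proof. by move=> _ _ a -> -> _; rewrite !mulr0 addr0. Qed.

End FuzzyNumbers.

Record fuzzyNumber (R : realType) := FuzzyNumber {
  fuzzy_fun :> R -> R;
  fuzzy_funP : is_fuzzy_number fuzzy_fun }.

Section Arithmetic.
Variable R : realType.
Implicit Types u v w : fuzzyNumber R.

Definition fadd u v : fuzzyNumber R :=
  FuzzyNumber (of_levels_fuzzy
    (minkowski_sum_family (fuzzy_funP u) (fuzzy_funP v))
    (fun l l01 => minkowski_sum_convex (level_convex (fuzzy_funP u) l01)
                                       (level_convex (fuzzy_funP v) l01))).

Definition fscale (c : R) u : fuzzyNumber R :=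
  FuzzyNumber (of_levels_fuzzy
    (minkowski_scale_family c (fuzzy_funP u))
    (fun l l01 => minkowski_scale_convex (level_convex (fuzzy_funP u) l01))).

Definition fzero : fuzzyNumber R :=
  FuzzyNumber (of_levels_fuzzy (@set1_family R) (fun _ _ => @set1_convex R)).

Lemma level_fadd u v (l : R) : 0 <= l <= 1 ->
  level (fadd u v) l = minkowski_sum (level u l) (level v l).
Proof.
by move=> l01; rewrite level_of_levels//; apply: minkowski_sum_family;
  exact: fuzzy_funP.
Qed.

Lemma level_fscale (c : R) u (l : R) : 0 <= l <= 1 ->
  level (fscale c u) l = minkowski_scale c (level u l).
Proof.
by move=> l01; rewrite level_of_levels//; apply: minkowski_scale_family;
  exact: fuzzy_funP.
Qed.

Lemma level_fzero (l : R) : 0 <= l <= 1 -> level fzero l = [set 0].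
Proof. by move=> l01; rewrite (level_of_levels (@set1_family R)). Qed.

Lemma level_inj u v :
  (forall l : R, 0 <= l <= 1 -> level u l = level v l) -> u = v.
Proof.
case: u => u fu; case: v => v fv /= uv.
suff uvE : u = v by case: _ / uvE fv {uv} => fv; rewrite (Prop_irrelevance fu fv).
have le (u' v' : R -> R) : is_fuzzy_number u' -> is_fuzzy_number v' ->
    (forall l : R, 0 <= l <= 1 -> level u' l = level v' l) ->
    forall x, u' x <= v' x.
  move=> fu' fv' E x; have /andP[] := fuzzy_itv fu' x.
  rewrite le_eqVlt => /predU1P[<- _|u0 u1].
    by case/andP: (fuzzy_itv fv' x).
  have : level u' (u' x) x by rewrite /level gt_eqF/=.
  have u01 : 0 <= u' x <= 1 by rewrite (ltW u0) u1.
  by rewrite (E _ u01) /level gt_eqF.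
apply/funext => x; apply/eqP; rewrite eq_le; apply/andP; split; [exact: le|apply: le => //].
by move=> l l01; rewrite uv.
Qed.

Lemma faddC : commutative fadd.
Proof.
move=> u v; apply: level_inj => l l01; rewrite !level_fadd//.
by apply/seteqP; split => _ [x ? [y ? <-]]; exists y => //; exists x => //; rewrite addrC.
Qed.

Lemma faddA : associative fadd.
Proof.
move=> u v w; apply: level_inj => l l01; rewrite !level_fadd//.
apply/seteqP; split.
  move=> _ [x ux [_ [y vy [z wz <-]] <-]]; exists (x + y); first by exists x => //; exists y.
  by exists z => //; rewrite addrA.
move=> _ [_ [x ux [y vy <-]] [z wz <-]]; exists x => //.
by exists (y + z); [exists y => //; exists z|rewrite addrA].
Qed.

Lemma fadd0 : left_id fzero fadd.
Proof.
move=> u; apply: level_inj => l l01; rewrite level_fadd// level_fzero//.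
apply/seteqP; split => [_ [_ -> [x ux <-]]|x ux]; first by rewrite add0r.
by exists 0 => //; exists x => //; rewrite add0r.
Qed.

(* [u + v] and [\sum_j u_ j] on fuzzy numbers denote [fadd] and its iteration.
   There is no semimodule structure for [fscale]: in general
   [fscale (a + b) u] differs from [fscale a u + fscale b u]. *)
HB.instance Definition _ := gen_eqMixin (fuzzyNumber R).
HB.instance Definition _ := gen_choiceMixin (fuzzyNumber R).
HB.instance Definition _ :=
  GRing.isNmodule.Build (fuzzyNumber R) faddA faddC fadd0.

(* [sup [set `|t| | t in level u 0]] is a genuine maximum. *)
Lemma fuzzy_abs_max u : exists2 z, level u 0 z &
  `|z| = sup [set `|t| | t in level u 0].
Proof.
have F := level_family (fuzzy_funP u).
have [x ux] := lf_nonempty F.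
have u0 : level u 0 !=set0.
  by exists x; apply: (lf_homo F) ux => //; exact: ler01.
have cn : {within level u 0, continuous (fun t : R => `|t|)}.
  by apply: continuous_subspaceT; exact: norm_continuous.
have [z + zmax] := compact_EVT_max u0 (fuzzy_compact (fuzzy_funP u)) cn.
rewrite inE => uz; exists z => //.
have ub : ubound [set `|t| | t in level u 0] `|z|.
  by move=> _ [t ut <-]; apply: zmax; rewrite inE.
apply/eqP; rewrite eq_le; apply/andP; split.
  by apply: ub_le_sup; [exists `|z| | exists z].
by apply: ge_sup => //; exists `|z|, z.
Qed.

End Arithmetic.

Section Endograph.
Variable R : realType.

Definition euclid_dist (p q : R * R) : R :=
  Num.sqrt ((p.1 - q.1) ^+ 2 + (p.2 - q.2) ^+ 2).

Definition dist_to (p : R * R) (A : set (R * R)) : R :=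
  inf [set euclid_dist p q | q in A].

Definition hausdorff_dist (A B : set (R * R)) : R :=
  Num.max (sup [set dist_to p B | p in A]) (sup [set dist_to q A | q in B]).

Definition endograph (u : R -> R) : set (R * R) :=
  [set p | 0 <= p.2 <= 1 /\ p.2 <= u p.1].

Definition D_E (u v : fuzzyNumber R) : R :=
  hausdorff_dist (endograph u) (endograph v).

(* Real-valued [inf] and [sup] default to [0] on empty or unbounded sets; the
   next two lemmas show that this never happens in [D_E]. *)
Lemma endograph_has_inf (p : R * R) (v : fuzzyNumber R) :
  has_inf [set euclid_dist p q | q in endograph v].
Proof.
split; last by exists 0 => _ [q _ <-]; exact: sqrtr_ge0.
exists (euclid_dist p (0, 0)), (0, 0) => //; split => /=; first by rewrite lexx ler01.
by have /andP[] := fuzzy_itv (fuzzy_funP v) 0.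
Qed.

Lemma endograph_has_sup (u v : fuzzyNumber R) :
  has_sup [set dist_to p (endograph v) | p in endograph u].
Proof.
split.
  exists (dist_to (0, 0) (endograph v)), (0, 0) => //; split => /=.
    by rewrite lexx ler01.
  by have /andP[] := fuzzy_itv (fuzzy_funP u) 0.
exists 1 => _ [[x b] [/= /andP[b0 b1] _] <-].
apply: (@le_trans _ _ (euclid_dist (x, b) (x, 0))).
  apply: ge_inf; first by have [] := endograph_has_inf (x, b) v.
  exists (x, 0) => //; split => /=; first by rewrite lexx ler01.
  by have /andP[] := fuzzy_itv (fuzzy_funP v) x.
by rewrite /euclid_dist/= subrr subr0 expr0n add0r sqrtr_sqr ger0_norm.
Qed.

End Endograph.

(* Main.v *)
Require Import Defs.
From mathcomp Require Import all_boot all_order all_algebra.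
From mathcomp Require Import all_classical all_reals all_analysis.
From mathcomp Require Import ring lra.

Set Implicit Arguments.
Unset Strict Implicit.
Unset Printing Implicit Defensive.

Import Order.TTheory GRing.Theory Num.Theory.
Import numFieldNormedType.Exports.

Local Open Scope classical_set_scope.
Local Open Scope ring_scope.

(** Each inequality bounds a Hausdorff distance [D_E f g] by some [r], and for
    that it is enough to approximate, within [r], every point of either
    endograph by a point of the other one ([D_E_le]). Points of height [0] lie
    in every endograph, so only a positive height [t] matters, and there
    membership of [(x, t)] is membership of [x] in the [t]-level; the levelwise
    arithmetic therefore moves points between endographs.
    - Two multiples [alpha u], [beta u]: a point of the first at height [t] is
      [alpha y] with [y] in the [t]-level of [u]; move it horizontally to
      [beta y].
    - Sums and convex combinations: split a point of the combination into
      points of the two terms at the same height [t], and approximate these. An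
      approximating point higher than [t] may be lowered to [t], as endographs
      are closed downwards ([D_E_approx_below]); the approximations then have
      heights [s1, s2 <= t] and combine at height [min s1 s2]. The vertical
      error of the combination is thus the larger of the two vertical errors,
      not their sum. For sums this leaves the triangle inequality of the plane.
      For convex combinations the square of the horizontal error is at most the
      sum of the squares of the two horizontal errors, and adding the square of
      one of the vertical errors stays below the sum of the two squared
      distances ([convex_min_sqr_dist]); conversely a point of [w] is
      approximated in [u] and in [v], and the two approximations are combined.
    The bound with [sqrt 2] follows from the one with the sum of squares.
    The infima in [D_E] yield approximating points at any distance
    [D_E + e] with [0 < e], and [e] tends to [0] at the end. *)

Section EndographMetric.
Variable R : realType.
Implicit Types (u v w : fuzzyNumber R) (a b c d e r s t x y : R).

(** * Plane geometry *)

Lemma minkowski_sqr a b c d r s : 0 <= r -> 0 <= s ->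
  a ^+ 2 + b ^+ 2 <= r ^+ 2 -> c ^+ 2 + d ^+ 2 <= s ^+ 2 ->
  (a + c) ^+ 2 + (b + d) ^+ 2 <= (r + s) ^+ 2.
Proof.
move=> r0 s0 abr cds.
have CS : a * c + b * d <= r * s.
  apply: (le_trans (ler_norm _)).
  rewrite -(@ler_pXn2r _ 2) ?nnegrE ?normr_ge0 ?mulr_ge0// real_normK ?num_real//.
  have -> : (r * s) ^+ 2 = r ^+ 2 * s ^+ 2 by ring.
  apply: (@le_trans _ _ ((a ^+ 2 + b ^+ 2) * (c ^+ 2 + d ^+ 2))); last first.
    by apply: ler_pM => //; rewrite addr_ge0 ?sqr_ge0.
  have -> : (a ^+ 2 + b ^+ 2) * (c ^+ 2 + d ^+ 2)
          = (a * c + b * d) ^+ 2 + (a * d - b * c) ^+ 2 by ring.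
  by rewrite lerDl sqr_ge0.
have -> : (a + c) ^+ 2 + (b + d) ^+ 2 =
  (a ^+ 2 + b ^+ 2) + (c ^+ 2 + d ^+ 2) + (a * c + b * d) *+ 2 by ring.
have -> : (r + s) ^+ 2 = r ^+ 2 + s ^+ 2 + (r * s) *+ 2 by ring.
by rewrite !lerD// lerMn2r CS orbT.
Qed.

Lemma add_min_sqr_dist x y x' y' t s1 s2 r1 r2 :
  0 <= r1 -> 0 <= r2 -> s1 <= t -> s2 <= t ->
  (x - x') ^+ 2 + (t - s1) ^+ 2 <= r1 ^+ 2 ->
  (y - y') ^+ 2 + (t - s2) ^+ 2 <= r2 ^+ 2 ->
  (x + y - (x' + y')) ^+ 2 + (t - Num.min s1 s2) ^+ 2 <= (r1 + r2) ^+ 2.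
Proof.
move=> r10 r20 s1t s2t d1 d2; rewrite opprD addrACA.
apply: le_trans (minkowski_sqr r10 r20 d1 d2); rewrite lerD2l.
rewrite ler_pXn2r ?nnegrE//; by case: (leP s1 s2) => ?; lra.
Qed.

(** The vertical error [t - min s1 s2] is one of [t - s1] and [t - s2], and the
    square of the horizontal one is at most the sum of the squares of the
    horizontal errors at [x] and [y]; the total thus contains each of the four
    squared errors at most once. *)
Lemma convex_min_sqr_dist x y x' y' t s1 s2 r1 r2 a : 0 <= a <= 1 ->
  s1 <= t -> s2 <= t ->
  (x - x') ^+ 2 + (t - s1) ^+ 2 <= r1 ^+ 2 ->
  (y - y') ^+ 2 + (t - s2) ^+ 2 <= r2 ^+ 2 ->
  (a * x + (1 - a) * y - (a * x' + (1 - a) * y')) ^+ 2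
    + (t - Num.min s1 s2) ^+ 2 <= r1 ^+ 2 + r2 ^+ 2.
Proof.
move=> /andP[a0 a1] s1t s2t.
set h1 := x - x'; set h2 := y - y' => d1 d2.
have -> : a * x + (1 - a) * y - (a * x' + (1 - a) * y')
        = a * h1 + (1 - a) * h2 by rewrite /h1 /h2; ring.
have hle : (a * h1 + (1 - a) * h2) ^+ 2 <= h1 ^+ 2 + h2 ^+ 2.
  apply: (@le_trans _ _ (a * h1 ^+ 2 + (1 - a) * h2 ^+ 2)).
    rewrite -subr_ge0.
    have -> : a * h1 ^+ 2 + (1 - a) * h2 ^+ 2 - (a * h1 + (1 - a) * h2) ^+ 2
            = a * (1 - a) * (h1 - h2) ^+ 2 by ring.
    by apply: mulr_ge0; [apply: mulr_ge0; rewrite ?subr_ge0|exact: sqr_ge0].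
  by rewrite lerD// ler_piMl ?sqr_ge0//; lra.
have k1 := sqr_ge0 (t - s1); have k2 := sqr_ge0 (t - s2).
by case: (leP s1 s2) => _; lra.
Qed.

(** * Points of endographs *)

Lemma endograph0 u x : endograph u (x, 0).
Proof.
by split => /=; [rewrite lexx ler01|case/andP: (fuzzy_itv (fuzzy_funP u) x)].
Qed.

Lemma endograph_le u x s t : 0 <= s <= t -> endograph u (x, t) ->
  endograph u (x, s).
Proof.
move=> /andP[s0 st] [/= /andP[_ t1] tu].
by split; [rewrite s0 (le_trans st)|exact: le_trans tu].
Qed.

Lemma endograph_level u x t : 0 < t <= 1 -> endograph u (x, t) <-> level u t x.
Proof.
move=> /andP[t0 t1]; rewrite /level gt_eqF//; split; first by case.
by move=> /= tu; split; rewrite ?(ltW t0).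
Qed.

Lemma endograph_pos u x t : 0 < t -> endograph u (x, t) -> 0 < t <= 1.
Proof. by move=> -> [/andP[]]. Qed.

Lemma endograph_min u x s t : endograph u (x, s) -> 0 <= t ->
  endograph u (x, Num.min s t).
Proof.
by move=> us t0; have [/andP[s0 _] _] := us; apply: endograph_le us;
  rewrite le_min s0 t0 ge_min lexx.
Qed.

(** At the height [min s t] both points lie in their endographs, so the
    levels there, if the height is positive, can be added. *)
Lemma endograph_add u v x y s t : endograph u (x, s) -> endograph v (y, t) ->
  endograph (fadd u v) (x + y, Num.min s t).
Proof.
move=> ux vy; have [/= /andP[s0 _] _] := ux; have [/= /andP[t0 _] _] := vy.
have {}ux := endograph_min ux t0.
have {}vy := endograph_min vy s0; rewrite minC in vy.
have : 0 <= Num.min s t by rewrite le_min s0.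
rewrite le_eqVlt => /predU1P[<-|m0]; first exact: (endograph0 (fadd u v)).
have m01 := endograph_pos m0 ux; apply/(endograph_level (fadd u v)) => //.
rewrite level_fadd; last by case/andP: m01 => _ ->; rewrite ltW.
by exists x; [|exists y]; [exact/endograph_level|exact/endograph_level|].
Qed.

Lemma endograph_add_inv u v x t : 0 < t -> endograph (fadd u v) (x, t) ->
  exists y z, [/\ x = y + z, endograph u (y, t) & endograph v (z, t)].
Proof.
move=> t0 uvx; have t01 := endograph_pos t0 uvx.
move: uvx => /endograph_level-/(_ t01); rewrite level_fadd; last first.
  by case/andP: t01 => _ ->; rewrite ltW.
by move=> [y uy [z vz <-]]; exists y, z; split => //; exact/endograph_level.
Qed.

Lemma endograph_scale c u x t : endograph u (x, t) ->
  endograph (fscale c u) (c * x, t).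
Proof.
move=> ux; have [/= /andP[+ _] _] := ux.
rewrite le_eqVlt => /predU1P[<-|t0]; first exact: (endograph0 (fscale c u)).
have t01 := endograph_pos t0 ux; apply/(endograph_level (fscale c u)) => //.
rewrite level_fscale; last by case/andP: t01 => _ ->; rewrite ltW.
by exists x => //; exact/endograph_level.
Qed.

Lemma endograph_scale_inv c u x t : 0 < t -> endograph (fscale c u) (x, t) ->
  exists2 y, x = c * y & endograph u (y, t).
Proof.
move=> t0 ux; have t01 := endograph_pos t0 ux.
move: ux => /endograph_level-/(_ t01); rewrite level_fscale; last first.
  by case/andP: t01 => _ ->; rewrite ltW.
by move=> [y uy <-]; exists y => //; exact/endograph_level.
Qed.

(** * The metric through approximation of points *)

Lemma D_EC u v : D_E u v = D_E v u.
Proof. by rewrite /D_E /hausdorff_dist maxC. Qed.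

Lemma D_E_ge0 u v : 0 <= D_E u v.
Proof.
rewrite /D_E /hausdorff_dist le_max; apply/orP; left.
apply: (@le_trans _ _ (dist_to (0, 0) (endograph v))).
  by apply: lb_le_inf; [exact: (endograph_has_inf (0, 0) v).1|
    move=> _ [q _ <-]; exact: sqrtr_ge0].
apply: ub_le_sup; first exact: (endograph_has_sup u v).2.
by exists (0, 0) => //; exact: endograph0.
Qed.

(** Asking for this at positive heights only is enough, since a point at height
    [0] belongs to both endographs ([endograph0]). *)
Definition approx r u v := forall x t, 0 < t -> endograph u (x, t) ->
  exists y s, endograph v (y, s) /\ (x - y) ^+ 2 + (t - s) ^+ 2 <= r ^+ 2.

Lemma D_E_le r u v : 0 <= r -> approx r u v -> approx r v u -> D_E u v <= r.
Proof.
suff half u' v' : 0 <= r -> approx r u' v' ->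
    sup [set dist_to p (endograph v') | p in endograph u'] <= r.
  by move=> r0 uv vu; rewrite /D_E /hausdorff_dist ge_max !half.
move=> r0 uv; apply: ge_sup; first exact: (endograph_has_sup u' v').1.
move=> _ [[x t] ux <-].
suff [y [s [vy d]]] : exists y s, endograph v' (y, s) /\
    (x - y) ^+ 2 + (t - s) ^+ 2 <= r ^+ 2.
  apply: (@le_trans _ _ (euclid_dist (x, t) (y, s))).
    apply: ge_inf; first exact: (endograph_has_inf (x, t) v').2.
    by exists (y, s).
  rewrite /euclid_dist -[leRHS](ger0_norm r0) -sqrtr_sqr.
  by rewrite ler_wsqrtr.
have [/= /andP[+ _] _] := ux; rewrite le_eqVlt => /predU1P[<-|t0]; last exact: uv.
exists x, 0; split; first exact: endograph0.
by rewrite !subrr expr0n addr0 sqr_ge0.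
Qed.

(** Truncating the height of an approximating point at [t] keeps it in the
    endograph and brings it closer to [(x, t)]. *)
Lemma D_E_approx_below r u v x t : D_E u v < r -> endograph u (x, t) ->
  exists y s, [/\ endograph v (y, s), s <= t &
                  (x - y) ^+ 2 + (t - s) ^+ 2 <= r ^+ 2].
Proof.
move=> uvr ux.
have dr : dist_to (x, t) (endograph v) < r.
  apply: le_lt_trans uvr; rewrite /D_E /hausdorff_dist le_max; apply/orP; left.
  by apply: ub_le_sup; [exact: (endograph_has_sup u v).2|exists (x, t)].
have [_ [[y s] vy <-] dyr] := inf_lt (endograph_has_inf (x, t) v).1 dr.
have t0 : 0 <= t by have [/andP[]] := ux.
exists y, (Num.min s t); split; [exact: endograph_min|by rewrite ge_min lexx orbT|].
have d0 : 0 <= (x - y) ^+ 2 + (t - s) ^+ 2 by rewrite addr_ge0 ?sqr_ge0.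
apply: (@le_trans _ _ ((x - y) ^+ 2 + (t - s) ^+ 2)).
  by rewrite lerD2l; case: (leP s t) => // _; rewrite subrr expr0n sqr_ge0.
have := ltW dyr; rewrite /euclid_dist/= -(@ler_pXn2r _ 2) ?nnegrE ?sqrtr_ge0//.
  by rewrite sqr_sqrtr.
exact: le_trans (sqrtr_ge0 _) (ltW dyr).
Qed.

(** * The inequalities *)

Lemma D_E_scale u a b : D_E (fscale a u) (fscale b u)
  <= `|a - b| * sup [set `|z| | z in level u 0].
Proof.
set M := sup _.
have M0 : 0 <= M by rewrite /M; have [z _ <-] := fuzzy_abs_max u.
have uM x t : 0 < t -> endograph u (x, t) -> `|x| <= M.
  move=> t0 ux; have /andP[_ t1] := endograph_pos t0 ux.
  have ux0 : level u 0 x.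
    apply: (lf_homo (level_family (fuzzy_funP u)) _ (ltW t0) t1) => //.
    by apply/endograph_level => //; rewrite t0.
  have cn : compact [set `|z| | z in level u 0].
    apply: continuous_compact (fuzzy_compact (fuzzy_funP u)).
    exact/continuous_subspaceT/norm_continuous.
  apply: ub_le_sup; last by exists x.
  by apply: (compact_has_sup _ cn).2; exists `|x|, x.
have H c d : approx (`|c - d| * M) (fscale c u) (fscale d u).
  move=> _ t t0 /(endograph_scale_inv t0)[y -> uy].
  exists (d * y), t; split; first exact: endograph_scale.
  rewrite subrr expr0n addr0 -mulrBl !exprMn real_normK ?num_real//.
  rewrite ler_wpM2l ?sqr_ge0// -(real_normK (num_real y)).
  by rewrite ler_pXn2r ?nnegrE//; exact: uM t0 uy.
apply: D_E_le; [by rewrite mulr_ge0|exact: H|by rewrite distrC; exact: H].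
Qed.

Lemma D_E_add u u' v v' : D_E (u + u') (v + v') <= D_E u v + D_E u' v'.
Proof.
apply/ler_addgt0Pr => e e0.
have e2 : 0 < e / 2 by rewrite divr_gt0.
have r0 f g : 0 <= D_E f g + e / 2 by rewrite addr_ge0 ?D_E_ge0 ?ltW.
have -> : D_E u v + D_E u' v' + e = (D_E u v + e / 2) + (D_E u' v' + e / 2).
  by field.
suff H (f f' g g' : fuzzyNumber R) :
    approx ((D_E f g + e / 2) + (D_E f' g' + e / 2)) (f + f') (g + g').
  apply: D_E_le; [exact: addr_ge0|exact: H|].
  by rewrite (D_EC u) (D_EC u'); exact: H.
move=> _ t t0 /(endograph_add_inv t0)[x [x' [-> fx fx']]].
have fg : D_E f g < D_E f g + e / 2 by rewrite ltrDl.
have fg' : D_E f' g' < D_E f' g' + e / 2 by rewrite ltrDl.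
have [y [s [gy st d]]] := D_E_approx_below fg fx.
have [y' [s' [gy' st' d']]] := D_E_approx_below fg' fx'.
exists (y + y'), (Num.min s s'); split; first exact: endograph_add.
exact: add_min_sqr_dist.
Qed.

Lemma D_E_sum (n : nat) (u_ v_ : 'I_n -> fuzzyNumber R) :
  D_E (\sum_(j < n) u_ j) (\sum_(j < n) v_ j) <= \sum_(j < n) D_E (u_ j) (v_ j).
Proof.
apply: (big_rec3 (fun r v u => D_E u v <= r)) => [|j r v u _ uvr].
  by apply: D_E_le => // x t t0 zx; exists x, t; rewrite !subrr !expr0n addr0.
by apply: le_trans (D_E_add _ _ _ _) _; rewrite lerD2l.
Qed.

(** Convex combinations of two points of the endograph of [w], taken at the
    smaller height, stay in it because [w] is quasiconcave. *)
Lemma D_E_convex u v w a : 0 <= a <= 1 ->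
  D_E (fscale a u + fscale (1 - a) v) w
  <= Num.sqrt (D_E u w ^+ 2 + D_E v w ^+ 2).
Proof.
move=> a01; set A := D_E u w; set B := D_E v w.
have A0 : 0 <= A := D_E_ge0 _ _; have B0 : 0 <= B := D_E_ge0 _ _.
apply/ler_addgt0Pr => e e0; set r := Num.sqrt _ + e.
have r0 : 0 <= r by rewrite addr_ge0 ?sqrtr_ge0 ?ltW.
pose e' := e / 2; have e'0 : 0 < e' by rewrite divr_gt0.
(* Both distances grow by [e / 2], which moves the vector [(A, B)] by
   [sqrt 2 * (e / 2) <= e]. *)
have ABr : (A + e') ^+ 2 + (B + e') ^+ 2 <= r ^+ 2.
  apply: minkowski_sqr; rewrite ?sqrtr_ge0 ?(ltW e0)//.
    by rewrite sqr_sqrtr ?addr_ge0 ?sqr_ge0.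
  have -> : e' ^+ 2 + e' ^+ 2 = e ^+ 2 / 2 by rewrite /e'; field.
  by have := sqr_ge0 e; lra.
have uw : D_E u w < A + e' by rewrite ltrDl.
have vw : D_E v w < B + e' by rewrite ltrDl.
apply: D_E_le => //.
- move=> _ t t0 /(endograph_add_inv t0)[p [q [->]]].
  move=> /(endograph_scale_inv t0)[x -> ux] /(endograph_scale_inv t0)[y -> vy].
  have [x' [s [wx' st d]]] := D_E_approx_below uw ux.
  have [y' [s' [wy' st' d']]] := D_E_approx_below vw vy.
  exists (a * x' + (1 - a) * y'), (Num.min s s'); split; last first.
    by apply: le_trans ABr; exact: convex_min_sqr_dist.
  have [/= /andP[s0 s1] wx] := wx'; have [/= /andP[s'0 _] wy] := wy'.
  split => /=; first by rewrite le_min s0 s'0 ge_min s1.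
  apply: le_trans (fuzzy_quasiconcave (fuzzy_funP w) _ _ a01).
  by rewrite le_min !ge_min wx wy orbT.
- rewrite D_EC in uw; rewrite D_EC in vw.
  move=> x t t0 wx.
  have [x' [s [ux' st d]]] := D_E_approx_below uw wx.
  have [y' [s' [vy' st' d']]] := D_E_approx_below vw wx.
  exists (a * x' + (1 - a) * y'), (Num.min s s'); split.
    by apply: endograph_add; exact: endograph_scale.
  apply: le_trans ABr.
  have {1}-> : x = a * x + (1 - a) * x by ring.
  exact: convex_min_sqr_dist.
Qed.

End EndographMetric.

Theorem proposition5p6 (R : realType) :
  [/\ (forall (u : fuzzyNumber R) (alpha beta : R),
        D_E (fscale alpha u) (fscale beta u)
        <= `|alpha - beta| * sup [set `|z| | z in level u 0]),
      (forall (n : nat) (u_ v_ : 'I_n -> fuzzyNumber R), (1 <= n)%N ->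
        D_E (\sum_(j < n) u_ j) (\sum_(j < n) v_ j)
        <= \sum_(j < n) D_E (u_ j) (v_ j)),
      (forall (u v w : fuzzyNumber R) (alpha : R), 0 <= alpha <= 1 ->
        D_E (fscale alpha u + fscale (1 - alpha) v) w
        <= Num.sqrt (D_E u w ^+ 2 + D_E v w ^+ 2))
    & (forall (u v w : fuzzyNumber R) (alpha : R), 0 <= alpha <= 1 ->
        D_E (fscale alpha u + fscale (1 - alpha) v) w
        <= Num.sqrt 2 * Num.max (D_E u w) (D_E v w))].
Proof.
split; [exact: D_E_scale|by move=> n u_ v_ _; exact: D_E_sum|exact: D_E_convex|].
move=> u v w a a01; apply: le_trans (D_E_convex u v w a01) _.
set m := Num.max _ _.
have m0 : 0 <= m by rewrite le_max D_E_ge0.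
rewrite -[m in leRHS]ger0_norm// -sqrtr_sqr -sqrtrM// ler_wsqrtr//.
by rewrite mulr_natl mulr2n lerD// ler_pXn2r ?nnegrE ?D_E_ge0// le_max lexx ?orbT.
Qed.
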